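(* Let $G$ be a group and $G+_{\partial}Y$ its maximal perspective compactification. If $p \in Y$ is a bounded parabolic point (of the action of $G$ on $G+_\partial Y$) and $Stab\ p+_{\partial_{p}} C_{p}$ is a perspective compactification of $Stab\ p$ (in particular $Stab\ p$ is dense in it), then $\#C_{p} = 1$.
   Context: Groups are discrete. An action of a group $H$ on a locally compact Hausdorff space $V$ is properly discontinuous if for every compact $K\subseteq V$ the set $\{h\in H: hK\cap K\neq\emptyset\}$ is finite, and cocompact if $HK=V$ for some compact $K\subseteq V$. A point $p$ of a compact Hausdorff $G$-space $Z$ is bounded parabolic if $Stab\ p$ acts properly discontinuously and cocompactly on $Z\setminus\{p\}$. For an entourage $u$ of the unique uniform structure compatible with a compact Hausdorff space, a subset $A$ is $u$-small if $A\times A\subseteq u$. $H+_\partial C$ denotes a topological space with underlying set $H\sqcup C$ in which $H$ is discrete and open and $C$ carries its given topology. A perspective compactification of a discrete group $H$ is a compact Hausdorff space $H+_\partial C$ in which $H$ is dense, with an action of $H$ by homeomorphisms extending left multiplication on $H$, such that for every entourage $u$ and every finite $F\subseteq H$ the set $\{h\in H: hF\text{ is not }u\text{-small}\}$ is finite. It is the maximal perspective compactification if for every perspective compactification $H+_{\partial'}C'$ there is a continuous equivariant map $H+_\partial C\to H+_{\partial'}C'$ that is the identity on $H$. *)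

(* Defs.v *)
From HB Require Import structures.
From mathcomp Require Import all_boot.
From mathcomp Require Import all_classical topology.

Set Implicit Arguments.
Unset Strict Implicit.
Unset Printing Implicit Defensive.

Local Open Scope classical_set_scope.

(* Each [act h] is a homeomorphism, with inverse [act h^-1]. *)
Record group_action (H : groupType) (V : topologicalType) := GroupAction {
  act :> H -> V -> V ;
  act1 : forall x, act 1%g x = x ;
  actM : forall g h x, act (g * h)%g x = act g (act h x) ;
  act_continuous : forall h, continuous (act h) }.

Definition properly_discontinuous (H : groupType) (V : topologicalType)
    (a : group_action H V) : Prop :=
  forall K : set V, compact K ->
    finite_set [set h : H | (a h @` K) `&` K !=set0].

Definition cocompact (H : groupType) (V : topologicalType)
    (a : group_action H V) : Prop :=
  exists2 K : set V, compact K & \bigcup_h (a h @` K) = [set: V].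

Section Stabilizer.
Variables (G : groupType) (Z : topologicalType) (a : group_action G Z) (p : Z).

Definition stab : {pred G} := fun g => `[< a g p = p >].

Lemma stabP g : reflect (a g p = p) (g \in stab).
Proof. exact: asboolP. Qed.

Lemma stab_group_closed : group_closed stab.
Proof.
split=> [|g h /stabP gp /stabP hp]; apply/stabP; first exact: act1.
suff hVp : a h^-1%g p = p by rewrite actM hVp.
by rewrite -[X in a _ X]hp -actM mulVg act1.
Qed.

Definition stabilizer : Type := {g : G | g \in stab}.
HB.instance Definition _ := [isSub of stabilizer for @sval _ _].
HB.instance Definition _ := [Choice of stabilizer by <:].
HB.instance Definition _ :=
  SubChoice_isSubGroup.Build G stab stabilizer stab_group_closed.

Lemma act_punctured (g : stabilizer) (x : ~` [set p]) :
  a (val g) (val x) \in ~` [set p].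
Proof.
apply/mem_set => /= gxp; have /set_mem := valP x; apply.
have /stabP gp := valP g.
have := congr1 (a (val g)^-1%g) gxp.
by rewrite -actM mulVg act1 -[X in _ = a _ X]gp -actM mulVg act1.
Qed.

Definition punctured_act (g : stabilizer) (x : ~` [set p]) : ~` [set p] :=
  SigSub (act_punctured g x).

Lemma punctured_act1 x : punctured_act 1%g x = x.
Proof. by apply/val_inj; rewrite /= act1. Qed.

Lemma punctured_actM g h x :
  punctured_act (g * h)%g x = punctured_act g (punctured_act h x).
Proof. by apply/val_inj; rewrite /= actM. Qed.

Lemma punctured_act_continuous g : continuous (punctured_act g).
Proof.
apply: continuous_comp_initial => x.
apply: (@continuous_comp _ _ _ (@set_val _ (~` [set p])) (a (val g))).
  exact: initial_continuous.
exact: act_continuous.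
Qed.

(* The space Z \ {p} carries the subspace topology ([set_type]). *)
Definition punctured_action : group_action stabilizer (~` [set p]) :=
  GroupAction punctured_act1 punctured_actM punctured_act_continuous.

Definition bounded_parabolic : Prop :=
  properly_discontinuous punctured_action /\ cocompact punctured_action.

End Stabilizer.

Definition topological_embedding (S T : topologicalType) (f : S -> T) : Prop :=
  injective f /\
  forall A : set S, open A <-> exists2 U : set T, open U & f @^-1` U = A.

Definition small (Z : uniformType) (u : set (Z * Z)) (A : set Z) : Prop :=
  A `*` A `<=` u.

(* [H +_d C]: the bijection [pc_pt] identifies the space with the disjoint
   union of H and C.  As a compact Hausdorff space has exactly one compatible
   uniform structure, asking for a [uniformType] is no extra datum: its
   entourages are those of that unique structure. *)
Record perspective_compactification (H : groupType) (C : topologicalType) :=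
  PerspectiveCompactification {
  pc_space :> uniformType ;
  pc_compact : compact [set: pc_space] ;
  pc_hausdorff : hausdorff_space pc_space ;
  pc_pt : H + C -> pc_space ;
  pc_pt_bij : bijective pc_pt ;
  pc_discrete :
    topological_embedding (pc_pt \o inl : discrete_topology H -> pc_space) ;
  pc_open : open (range (pc_pt \o inl)) ;
  pc_remainder : topological_embedding (pc_pt \o inr) ;
  pc_dense : dense (range (pc_pt \o inl)) ;
  pc_act : group_action H pc_space ;
  pc_act_inl : forall g h, pc_act g (pc_pt (inl h)) = pc_pt (inl (g * h)%g) ;
  pc_perspective : forall u : set (pc_space * pc_space), entourage u ->
    forall F : set H, finite_set F ->
      finite_set [set h : H |
        ~ small u [set pc_pt (inl (h * f)%g) | f in F]] }.

Arguments pc_pt {H C} p _.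
Arguments pc_act {H C} p.

Definition maximal_perspective (H : groupType) (C : topologicalType)
    (Z : perspective_compactification H C) : Prop :=
  forall (C' : topologicalType) (Z' : perspective_compactification H C'),
    exists f : Z -> Z',
      [/\ continuous f,
          (forall h x, f (pc_act Z h x) = pc_act Z' h (f x)) &
          (forall h, f (pc_pt Z (inl h)) = pc_pt Z' (inl h))].

(* Main.v *)
(* Were there two points in C_p, a continuous w : W -> [0,1] would separate
   them, and its restriction phi to P = Stab p would be slowly oscillating:
   phi h - phi (h s) tends to 0 as h leaves finite sets, for each s.  With K a
   compact fundamental domain of P on Z \ {p} and theta a bump function equal
   to 1 on K and vanishing near p, the function
     f g = sup_(h in P) phi h * theta (h^-1 g)
   is slowly oscillating on all of G: away from p only finitely many h
   contribute, and near p all contributing h are of the form h0 s with s in a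
   fixed finite set.  The closure of the graph-like orbit map
   g |-> (k |-> (k g, f (k g))) in (Z * R)^G is a perspective compactification,
   so maximality of Z makes f extend continuously to Z.  As h -> p when h goes to
   infinity in P and f h - phi h -> 0, phi converges at infinity,
   contradicting the density of P in W, where w separates two points.  C_p is
   nonempty because a finite P would make p an isolated point of Z. *)
Require Import Defs.
From HB Require Import structures.
From mathcomp Require Import all_boot all_order all_algebra finmap ring lra.
From mathcomp Require Import all_classical all_reals topology normedtype.
From mathcomp Require Import Rstruct.

Import Order.TTheory GRing.Theory Num.Theory.
Import numFieldNormedType.Exports.

Set Implicit Arguments.
Unset Strict Implicit.
Unset Printing Implicit Defensive.

Local Open Scope classical_set_scope.

(** * Cofinite filters *)

Definition cofinitely (T : Type) : set_system T := [set A | finite_set (~` A)].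

Instance cofinitely_filter (T : Type) : Filter (@cofinitely T).
Proof.
split=> [|A B fA fB|A B AB]; rewrite /cofinitely /=.
- by rewrite setCT.
- by rewrite setCI finite_setU.
- by apply: sub_finite_set; exact: subsetC.
Qed.

Lemma cofinitelyC (T : Type) (A : set T) :
  finite_set A -> cofinitely (~` A).
Proof. by rewrite /cofinitely /= setCK. Qed.

Lemma cofinitely_inj (T U : Type) (f : T -> U) (A : set U) :
  injective f -> cofinitely A -> cofinitely (f @^-1` A).
Proof.
by move=> finj fA; apply: (finite_preimage _ fA) => x y _ _; exact: finj.
Qed.

Lemma cofinitely_mull (H : groupType) (A : set H) (g : H) :
  cofinitely A -> \forall h \near @cofinitely H, A (g * h)%g.
Proof. by apply: cofinitely_inj; exact: mulgI. Qed.

Lemma cofinitely_mulr (H : groupType) (A : set H) (g : H) :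
  cofinitely A -> \forall h \near @cofinitely H, A (h * g)%g.
Proof. by apply: (cofinitely_inj (@mulIg _ g)). Qed.

Lemma filter_finite_set (I : choiceType) (T : Type) (F : set_system T)
    (D : set I) (P : I -> T -> Prop) :
  Filter F -> finite_set D -> (forall i, D i -> \forall x \near F, P i x) ->
  \forall x \near F, forall i, D i -> P i x.
Proof.
move=> FF Dfin DP.
have : F (\bigcap_(i in [set` fset_set D]) P i).
  by apply: filter_bigI => i; rewrite in_fset_set // inE; exact: DP.
apply: filterS => x Px i Di; apply: Px => /=.
by rewrite in_fset_set // inE.
Qed.

(** * Group elements and remainder of a perspective compactification *)

Section PerspectiveCompactification.
Context {H : groupType} {C : topologicalType} (Z : perspective_compactification H C).

Definition pc_elt (h : H) : Z := pc_pt Z (inl h).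

Lemma pc_act_elt g h : pc_act Z g (pc_elt h) = pc_elt (g * h)%g.
Proof. exact: pc_act_inl. Qed.

Lemma pc_elt_neq_inr h c : pc_elt h <> pc_pt Z (inr c).
Proof. by move/(bij_inj (pc_pt_bij Z)). Qed.

(** Perspectivity makes [h] and [h * g] uniformly close for all but finitely many [h], so [h * g]
    follows [h] towards [x]. The equation [x' = pc_elt h] couples the two variables in the shape
    that the near-covering form of compactness consumes. *)
Lemma pc_near_translate (x : Z) (g : H) (U : set Z) : nbhs x U ->
  \forall x' \near x & h \near @cofinitely H,
    x' = pc_elt h -> U (pc_elt (h * g)%g).
Proof.
rewrite -nbhs_entourageE => -[u entu uU].
have entv := entourage_split_ent entu.
have := pc_perspective entv (finite_set2 1%g g).
set A := (X in finite_set X) => Afin.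
have nA := cofinitelyC Afin.
near=> x' h => /= x'E; apply/uU/xsectionP.
apply: (entourage_split x') => //.
  by apply/xsectionP; near: x'; exact: nbhs_entourage.
rewrite x'E.
have /contrapT : (~` A) h by near: h.
apply; split; [exists 1%g; rewrite ?mulg1 //|exists g => //]; [by left|by right].
Unshelve. all: by end_near. Qed.

(** Near each point [x], both [q h] and [q (h * g)] are close to [q x] once finitely many [h] are
    discarded; compactness of the space yields one cofinite set that works for all [x]. *)
Lemma pc_uniformly_slow (V : uniformType) (q : Z -> V) (u : set (V * V)) g :
  continuous q -> entourage u ->
  \forall h \near @cofinitely H, u (q (pc_elt h), q (pc_elt (h * g)%g)).
Proof.
move=> qc entu.
have /compact_near_coveringP cov := @pc_compact _ _ Z.
suff Lh x : [set: Z] x -> \forall x' \near x & h \near @cofinitely H,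
    x' = pc_elt h -> u (q (pc_elt h), q (pc_elt (h * g)%g)).
  apply: filterS (cov _ _ _ _ Lh) => h Zh; exact: (Zh (pc_elt h) I erefl).
move=> _.
pose v := split_ent u; have entv : entourage v := entourage_split_ent entu.
have [[A B] [nA nB] AB] := @pc_near_translate x g _ (qc x _ (nbhs_entourage (q x) entv)).
have qx := qc x _ (nbhs_entourage (q x) (entourage_inv entv)).
near=> x' h => /= x'E; apply: (entourage_split (q x)) => //.
  by rewrite -x'E; apply/xsectionP; near: x'; exact: qx.
apply/xsectionP; apply: (AB (x', h)) => //.
by split; [near: x'|near: h].
Unshelve. all: by end_near. Qed.

Lemma pc_elt_open h : open [set pc_elt h].
Proof.
have [_ /(_ [set h])[+ _]] := pc_discrete Z.
case; first exact: discrete_open.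
move=> U oU Uh.
have -> : [set pc_elt h] = U `&` range (pc_pt Z \o inl).
  apply/seteqP; split=> [_ ->|x [Ux [k _ kx]]].
    by split; [have : ((pc_pt Z \o inl) @^-1` U) h by rewrite Uh|exists h].
  rewrite -kx in Ux *.
  by have : ((pc_pt Z \o inl) @^-1` U) k by []; rewrite Uh => ->.
by apply: openI => //; exact: pc_open.
Qed.

(** If [C] were empty, every point would be an isolated group element, and compactness would give a
    cofinite set of [h] that differ from every point, themselves included; so [H] would be
    finite. *)
Lemma pc_remainder_nonempty : infinite_set [set: H] -> exists c : C, True.
Proof.
move=> Hinf; apply: contrapT => C0; apply: Hinf.
have /compact_near_coveringP cov := @pc_compact _ _ Z.
suff cv x : [set: Z] x -> \forall x' \near x & h \near @cofinitely H,
    x' <> pc_elt h.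
  apply: sub_finite_set (cov _ _ _ _ cv) => h _ /(_ (pc_elt h) I).
  exact.
have [f fK Kf] := pc_pt_bij Z.
rewrite -[x]Kf; case: (f x) => [h _|c]; last by case: C0; exists c.
exists ([set pc_elt h], [set~ h]).
  split; first by apply: open_nbhs_nbhs; split; [exact: pc_elt_open|].
  exact/cofinitelyC/finite_set1.
move=> [_ k] [/= -> kh] /(bij_inj (pc_pt_bij Z)) [hk]; exact: kh.
Qed.

(** Removing the finitely many elements outside [A] from an open neighbourhood of a remainder point
    leaves an open neighbourhood of it, which density makes meet the group. *)
Lemma pc_elt_near_inr (c : C) (U : set Z) (A : set H) :
  nbhs (pc_pt Z (inr c)) U -> cofinitely A -> exists2 h, A h & U (pc_elt h).
Proof.
rewrite nbhsE => -[V [oV Vc] VU] fA.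
have cB : closed (pc_elt @` ~` A).
  have /accessible_finite_set_closed := hausdorff_accessible (@pc_hausdorff _ _ Z).
  by apply; exact: finite_image.
have oVB : open (V `&` ~` (pc_elt @` ~` A)).
  by apply: openI => //; exact: closed_openC.
have VBc : (V `&` ~` (pc_elt @` ~` A)) (pc_pt Z (inr c)).
  by split=> // -[h _]; exact: pc_elt_neq_inr.
have [x [[Vx nx] [h _ hx]]] := @pc_dense _ _ Z _ (ex_intro _ _ VBc) oVB.
rewrite -hx in Vx nx.
exists h; last exact: VU.
by apply: contrapT => nAh; apply: nx; exists h.
Qed.

End PerspectiveCompactification.

(** * Compact sets in the subspace topology *)

Lemma compact_preimage_set_val (X : topologicalType) (A K : set X) :
  K `<=` A -> compact K -> compact (set_val @^-1` K : set A).
Proof.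
move=> KA cK F FF FK.
have GK : (set_val @ F) K by [].
have [x [Kx clx]] := cK _ (fmap_proper_filter _ FF) GK.
exists (SigSub (mem_set (KA _ Kx))); split=> // U V FU [_ [[B oB <-] Bx BV]].
have [] := clx (set_val @` U) B.
- by apply: (@filterS _ F _ U) => // y Uy; exists y.
- exact: open_nbhs_nbhs.
- by move=> _ [[y Uy <-] By]; exists y; split=> //; exact: BV.
Qed.

Lemma compact_set_type (X : topologicalType) (A : set X) :
  compact A -> compact [set: A].
Proof.
move=> /(compact_preimage_set_val (@subset_refl _ A)); congr (compact _).
by apply/seteqP; split=> // x _; exact: set_valP.
Qed.

(** * Perspective compactifications as closures of orbits *)

Section ClosureCompactification.
Variables (H : groupType) (X : uniformType) (a : group_action H X) (e : H -> X).
Hypothesis hausX : hausdorff_space X.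
Hypothesis e_equivariant : forall g h, a g (e h) = e (g * h)%g.
Hypothesis e_isolated : forall h, exists2 U, open U & e @^-1` U = [set h].
Hypothesis e_perspective : forall u g, entourage u ->
  \forall h \near @cofinitely H, u (e h, e (h * g)%g).
Hypothesis e_precompact : compact (closure (range e)).

Let S := closure (range e).

Let mem_S h : e h \in S.
Proof. by apply/mem_set/subset_closure; exists h. Qed.

Let eS (h : H) : S := SigSub (mem_S h).

Let e_fiber h U k : e @^-1` U = [set h] -> U (e k) -> k = h.
Proof. by move=> Uh Uk; have : (e @^-1` U) k by []; rewrite Uh. Qed.

Let e_isolated_self h U : e @^-1` U = [set h] -> U (e h).
Proof. by move=> Uh; have : (e @^-1` U) h by rewrite Uh. Qed.

Let e_inj : injective e.
Proof.
move=> g h gh; have [U _ Uh] := e_isolated h.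
by apply: (e_fiber Uh); rewrite gh; exact: e_isolated_self.
Qed.

Let eS_inj : injective eS.
Proof. by move=> g h /(congr1 val)/e_inj. Qed.

(** A point of [S] in [U] is a limit of orbit points lying in [U], and [e h] is the only one; the
    Hausdorff property identifies the two. *)
Let S_cap_isolated h U x : open U -> e @^-1` U = [set h] -> S x -> U x ->
  x = e h.
Proof.
move=> oU Uh Sx Ux; apply/esym/hausX => A B nA nB.
have [_ [[k _ <-] [Bk Uk]]] := Sx _ (filterI nB (open_nbhs_nbhs (conj oU Ux))).
rewrite (e_fiber Uh Uk) in Bk.
by exists (e h); split=> //; exact: nbhs_singleton.
Qed.

Let C := ~` range eS.

Let pt (x : H + C) : S := match x with inl h => eS h | inr c => set_val c end.

Let pt_bij : bijective pt.
Proof.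
rewrite -setTT_bijective; split=> //.
- move=> [h|c] [k|d] _ _ /=.
  + by move/eS_inj ->.
  + by move=> hd; have := set_valP d; case; exists h.
  + by move=> ck; have := set_valP c; case; exists k.
  + by move=> cd; congr inr; exact: val_inj.
- move=> x _ /=; have [[h _ <-]|nx] := pselect (range eS x).
    by exists (inl h).
  by exists (inr (SigSub (mem_set (nx : C x)))).
Qed.

Let pt_discrete :
  topological_embedding (pt \o inl : discrete_topology H -> S).
Proof.
split=> [g h|A]; first exact: eS_inj.
split=> [_|_]; last exact: discrete_open.
have /choice [U Uh] : forall h, exists U : set X, open U /\ e @^-1` U = [set h].
  by move=> h; have [U] := e_isolated h; exists U.
exists (set_val @^-1` (\bigcup_(h in A) U h)).
  by exists (\bigcup_(h in A) U h) => //; apply: bigcup_open => h _; case: (Uh h).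
apply/seteqP; split=> [k [h Ah Uhk]|h Ah].
  by rewrite (e_fiber (Uh h).2 Uhk).
by exists h => //; apply: e_isolated_self; case: (Uh h).
Qed.

Let pt_open : open (range (pt \o inl)).
Proof.
have -> : range (pt \o inl) = \bigcup_h [set eS h].
  by apply/seteqP; split=> [_ [h _ <-]|_ [h _ ->]]; exists h.
apply: bigcup_open => h _; have [U oU Uh] := e_isolated h.
exists U => //; apply/seteqP; split=> [x Ux|_ ->]; last exact: e_isolated_self.
by apply: val_inj; apply: S_cap_isolated Ux => //; exact: set_valP.
Qed.

Let pt_remainder : topological_embedding (pt \o inr).
Proof.
split=> [c d /val_inj //|A]; split=> [[U oU UA]|[U oU UA]]; exists U => //.
Qed.

Let pt_dense : dense (range (pt \o inl)).
Proof.
move=> O [x Ox] [U oU UO]; rewrite -UO in Ox *.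
have [_ [[h _ <-] Uh]] := set_valP x _ (open_nbhs_nbhs (conj oU Ox)).
by exists (eS h); split=> //; exists h.
Qed.

Let act_S g x : S x -> S (a g x).
Proof.
move=> Sx U nU; have [_ [[h _ <-] Uh]] := Sx _ (act_continuous nU).
by exists (a g (e h)); split=> //; rewrite e_equivariant; exists (g * h)%g.
Qed.

Let actS (g : H) (x : S) : S := SigSub (mem_set (@act_S g _ (set_valP x))).

Let actS1 x : actS 1%g x = x.
Proof. by apply/val_inj => /=; exact: act1. Qed.

Let actSM g h x : actS (g * h)%g x = actS g (actS h x).
Proof. by apply/val_inj => /=; exact: actM. Qed.

Let actS_continuous g : continuous (actS g).
Proof.
apply: continuous_comp_initial => x.
apply: (@continuous_comp _ _ _ (@set_val _ S) (a g)).
  exact: initial_continuous.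
exact: act_continuous.
Qed.

Let actionS : group_action H S := GroupAction actS1 actSM actS_continuous.

Let actS_pt g h : actionS g (pt (inl h)) = pt (inl (g * h)%g).
Proof. by apply/val_inj => /=; exact: e_equivariant. Qed.

Let S_hausdorff : hausdorff_space S.
Proof.
move=> x y clxy; apply/val_inj/hausX => A B nA nB.
have [z [Az Bz]] := clxy _ _ (initial_continuous nA) (initial_continuous nB).
by exists (set_val z).
Qed.

Let S_perspective (u : set (S * S)) : entourage u ->
  forall F : set H, finite_set F ->
    finite_set [set h : H | ~ small u [set pt (inl (h * f)%g) | f in F]].
Proof.
move=> [v entv vu] F Ffin.
have Fv f : F f -> \forall h \near @cofinitely H, forall f', F f' ->
    v (e (h * f)%g, e (h * f')%g).
  move=> _; apply: filter_finite_set => // f' _.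
  (* The pair [h * f], [h * f'] consists of the base point [h * f] and its right translate by
     [f^-1 * f']. *)
  have := cofinitely_mulr f (e_perspective (f^-1 * f')%g entv).
  by apply: filterS => h; rewrite -mulgA mulVKg.
have : \forall h \near @cofinitely H, forall f, F f -> forall f', F f' ->
    v (e (h * f)%g, e (h * f')%g) by exact: filter_finite_set.
apply: sub_finite_set => h /=; apply: contra_not => hv.
by move=> [_ _] [/= [f Ff <-] [f' Ff' <-]]; apply: vu => /=; exact: hv.
Qed.

(** The space is the closure of the orbit, the remainder what the closure adds to the orbit, and [i]
    the inclusion. Keeping [i] in the conclusion allows coordinate functions on [X] to be pulled
    back. *)
Lemma closure_compactification :
  exists (C' : topologicalType) (Z : perspective_compactification H C')
    (i : Z -> X), continuous i /\ forall h, i (pc_elt Z h) = e h.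
Proof.
pose Z := PerspectiveCompactification (compact_set_type e_precompact)
  S_hausdorff pt_bij pt_discrete pt_open pt_remainder pt_dense
  (pc_act := actionS) actS_pt S_perspective.
exists C, Z, set_val; split=> //; exact: initial_continuous.
Qed.

End ClosureCompactification.

Local Open Scope ring_scope.

(** * Product spaces and extension of slowly oscillating functions *)

Lemma continuous_prod_topology (T : topologicalType) (I : eqType)
    (K : I -> topologicalType) (f : T -> prod_topology K) :
  (forall i, continuous (fun x => f x i)) -> continuous f.
Proof.
move=> fc x; apply/cvg_sup => i.
by apply: (@continuous_comp_initial _ _ _ (fun g : forall i, K i => g i)
  (f : T -> initial_topology (fun g : forall i, K i => g i))); exact: fc.
Qed.

(** Entourages of a product contain finite intersections of pullbacks of coordinate entourages, and
    a filter absorbs these. *)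
Lemma prod_topology_entourage_sub (I : choiceType) (K : I -> uniformType)
    (F : set_system (prod_topology K * prod_topology K)) : Filter F ->
  (forall i (v : set (K i * K i)), entourage v ->
    \forall xy \near F, v (xy.1 i, xy.2 i)) ->
  @entourage (prod_topology K) `<=` F.
Proof.
move=> FF Fi u [v [D _ <-] vu]; apply: filterS vu _.
apply: filter_bigI => -[[i w] /= /asboolP[w' entw' w'w]] _.
by apply: filterS (Fi i _ entw') => xy; exact: w'w.
Qed.

Lemma hausdorff_prod (T U : topologicalType) :
  hausdorff_space T -> hausdorff_space U -> hausdorff_space (T * U)%type.
Proof.
move=> hT hU [x1 x2] [y1 y2] clxy; congr pair.
  apply: hT => A B nA nB.
  have [|z [Az Bz]] := clxy (fst @^-1` A) (fst @^-1` B) (cvg_fst nA) _.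
    exact: cvg_fst nB.
  by exists z.1.
apply: hU => A B nA nB.
have [|z [Az Bz]] := clxy (snd @^-1` A) (snd @^-1` B) (cvg_snd nA) _.
  exact: cvg_snd nB.
by exists z.2.
Qed.

(** The vanishing variation of Higson functions. Translation is on the right, matching the sets
    [h F] of the perspective axiom. *)
Definition slowly_oscillating (R : realType) (H : groupType) (f : H -> R) :=
  forall g (eps : R), 0 < eps ->
    \forall h \near @cofinitely H, `|f h - f (h * g)%g| < eps.

Section Extension.
Variables (R : realType) (H : groupType) (C : topologicalType)
  (Z : perspective_compactification H C) (f : H -> R).
Hypothesis Zmax : maximal_perspective Z.
Hypothesis f01 : forall h, 0 <= f h <= 1.
Hypothesis f_slow : slowly_oscillating f.

Let X := prod_topology (fun _ : H => (Z * R)%type).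

(** Recording the values at all [k * h] makes [e] equivariant for the shift, although [f] itself is
    not invariant. The factor [Z] isolates the orbit points and the factor [R] carries [f]. *)
Let e (h : H) : X := fun k => (pc_elt Z (k * h)%g, f (k * h)%g).

Let shift (g : H) (x : X) : X := fun k => x (k * g)%g.

Let shift1 x : shift 1%g x = x.
Proof. by apply/funext => k; rewrite /shift mulg1. Qed.

Let shiftM g h x : shift (g * h)%g x = shift g (shift h x).
Proof. by apply/funext => k; rewrite /shift mulgA. Qed.

Let shift_continuous g : continuous (shift g).
Proof. by apply: continuous_prod_topology => k; exact: proj_continuous. Qed.

Let shift_action : group_action H X := GroupAction shift1 shiftM shift_continuous.

(** Maximality maps [Z] to the orbit closure of [e]; the real component of the coordinate at 1 is
    then a continuous function on [Z] that restricts to [f]. *)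
Lemma slowly_oscillating_extends :
  exists2 F : Z -> R, continuous F & forall h, F (pc_elt Z h) = f h.
Proof.
have hausX : hausdorff_space X.
  apply: hausdorff_product => k; apply: hausdorff_prod; first exact: pc_hausdorff.
  exact: Rhausdorff.
have eE g h : shift_action g (e h) = e (g * h)%g.
  by apply/funext => k; rewrite /= /shift /e mulgA.
have eI h : exists2 U, open U & e @^-1` U = [set h].
  exists ((fun x : X => (x 1%g).1) @^-1` [set pc_elt Z h]).
    apply: open_comp; last exact: pc_elt_open.
    move=> x _; apply: (@continuous_comp _ _ _ (fun x : X => x 1%g) fst).
      exact: proj_continuous.
    exact: cvg_fst.
  apply/seteqP; split=> [k /= |k -> /=]; rewrite mul1g //.
  by move/(bij_inj (pc_pt_bij Z)) => [].
have eP u g : entourage u -> \forall h \near @cofinitely H, u (e h, e (h * g)%g).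
  (* The sets [u] with the required eventual property form a filter, so coordinate entourages
     suffice. *)
  move: u; apply: prod_topology_entourage_sub => k v.
  case=> [[vZ vR] [/= entZ entR] sv].
  have nZ := cofinitely_mull k (pc_uniformly_slow g (fun x => cvg_id) entZ).
  have [eps eps0 epsR] : exists2 eps : R, 0 < eps &
      [set xy | `|xy.1 - xy.2| < eps] `<=` vR.
    by move: entR; rewrite -entourage_ballE => -[eps eps0 ?]; exists eps.
  have nR := cofinitely_mull k (f_slow g eps0).
  suff : \forall h \near @cofinitely H, v (e h k, e (h * g)%g k) by [].
  near=> h.
  (* A product entourage is given up to the reordering of [((z, r), (z', r'))] into
     [((z, z'), (r, r'))]; [sv] takes the second form. *)
  have [] := sv ((pc_elt Z (k * h)%g, pc_elt Z (k * (h * g))%g),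
    (f (k * h)%g, f (k * (h * g))%g)).
    split=> /=; first by rewrite mulgA; near: h; exact: nZ.
    by apply: epsR => /=; rewrite mulgA; near: h; exact: nR.
  by move=> [[a b] [c d]] /= vabcd [aE cE bE dE]; rewrite /e -aE -bE -cE -dE.
have ecpt : compact (closure (range e)).
  have ccyl : compact [set x : X | forall k, ([set: Z] `*` `[0, 1]%classic) (x k)].
    apply: (@tychonoff H (fun=> (Z * R)%type) (fun=> [set: Z] `*` `[0, 1]%classic)) => k.
    apply: compact_setX; first exact: pc_compact.
    exact: segment_compact.
  apply: (subclosed_compact _ ccyl); first exact: closed_closure.
  have /closure_id -> := compact_closed hausX ccyl.
  apply: closureS => _ [h _ <-] k; split=> //=.
  by rewrite in_itv /= f01.
have [C' [Z' [i [ic ie]]]] := closure_compactification hausX eE eI eP ecpt.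
have [F [Fc _ FE]] := Zmax Z'.
exists (fun z => (i (F z) 1%g).2); last by move=> h; rewrite FE ie /e mul1g.
move=> z; apply: (@continuous_comp _ _ _ (fun z => i (F z) 1%g) snd); last exact: cvg_snd.
apply: (@continuous_comp _ _ _ (fun z => i (F z)) (fun x : X => x 1%g)).
  by apply: continuous_comp; [exact: Fc|exact: ic].
exact: proj_continuous.
Unshelve. all: by end_near. Qed.

End Extension.

(** The supremum is 1-Lipschitz for the uniform distance. The bounds and the index [i0] ensure that
    both suprema are genuine rather than default values of [sup]. *)
Lemma sup_range_dist (R : realType) (I : Type) (u v : I -> R) (i0 : I) (eps : R) :
  (forall i, 0 <= u i <= 1) -> (forall i, 0 <= v i <= 1) ->
  (forall i, `|u i - v i| <= eps) -> `|sup (range u) - sup (range v)| <= eps.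
Proof.
have half (w z : I -> R) : (forall i, 0 <= z i <= 1) ->
    (forall i, `|w i - z i| <= eps) -> sup (range w) <= sup (range z) + eps.
  move=> z01 wz; apply: ge_sup; first by exists (w i0), i0.
  move=> _ [i _ <-]; rewrite -lerBlDr.
  apply: le_trans (_ : z i <= _).
    by rewrite lerBlDr -lerBlDl (le_trans (ler_norm _)).
  apply: ub_le_sup; last by exists i.
  by exists 1 => _ [j _ <-]; case/andP: (z01 j).
move=> u01 v01 uv; rewrite ler_distl lerBlDr !half //.
by move=> i; rewrite distrC.
Qed.

(** * Dynamics of the stabilizer at a bounded parabolic point *)

Section Parabolic.
Context {G : groupType} {Y : topologicalType} (Z : perspective_compactification G Y).
Variable y : Y.
Let p : Z := pc_pt Z (inr y).
Hypothesis hp : bounded_parabolic (pc_act Z) p.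
Let P := stabilizer (pc_act Z) p.
Let a (h : P) : Z -> Z := pc_act Z (val h).

Let a_mul g h x : a (g * h)%g x = a g (a h x).
Proof. exact: actM. Qed.

Let a_invK h x : a h^-1%g (a h x) = x.
Proof. by rewrite -a_mul mulVg; exact: act1. Qed.

Let aK_inv h x : a h (a h^-1%g x) = x.
Proof. by rewrite -a_mul mulgV; exact: act1. Qed.

Let a_fix h : a h p = p.
Proof. by apply/(stabP (pc_act Z) p); exact: valP. Qed.

Let a_neq h x : x <> p -> a h x <> p.
Proof. by move=> xp hxp; apply: xp; rewrite -(a_invK h x) hxp a_fix. Qed.

(** Proper discontinuity is applied to the single compact set [L] united with [M], viewed in the
    punctured space. *)
Lemma parabolic_finite (L M : set Z) : compact L -> compact M -> ~ L p -> ~ M p ->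
  finite_set [set h : P | (a h @` L) `&` M !=set0].
Proof.
move=> cL cM Lp Mp.
have cLM : compact (L `|` M) by exact: compactU.
have LMp : L `|` M `<=` ~` [set p] by move=> x [Lx|Mx] xp; [apply: Lp|apply: Mp]; rewrite -xp.
have := hp.1 _ (compact_preimage_set_val LMp cLM).
apply: sub_finite_set => h [_ [[x Lx <-] Mhx]].
have xp : x <> p by move=> xp; apply: Lp; rewrite -xp.
exists (SigSub (mem_set (a_neq xp : (~` [set p]) (a h x)))); split; last by right.
by exists (SigSub (mem_set (xp : (~` [set p]) _))); [left|exact: val_inj].
Qed.

Lemma parabolic_cover : exists K : set Z, [/\ compact K, ~ K p &
  forall x, x <> p -> exists h k, K k /\ x = a h k].
Proof.
have [K cK KE] := hp.2; exists (set_val @` K); split.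
- apply: (@continuous_compact (~` [set p]) Z set_val) => //; apply: continuous_subspaceT => x.
  exact: initial_continuous.
- by move=> [x _ xp]; exact: (set_valP x xp).
- move=> x xp.
  have : [set: ~` [set p]] (SigSub (mem_set (xp : (~` [set p]) _))) by [].
  rewrite -KE => -[h _ [k Kk kx]]; exists h, (val k); split; first by exists k.
  by have := congr1 val kx.
Qed.

(** Outside an open neighbourhood of [p] the space is compact and misses [p], so only finitely many
    translates of the point 1 under [P] fall there. *)
Lemma stab_elt_cvg (U : set Z) : nbhs p U ->
  \forall h \near @cofinitely P, U (pc_elt Z (val h)).
Proof.
rewrite nbhsE => -[V [oV Vp] VU].
have cV : compact (~` V).
  by apply: (subclosed_compact _ (@pc_compact _ _ Z)) => //; exact: open_closedC.
have := parabolic_finite (@compact_set1 Z (pc_elt Z 1%g)) cV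
  (fun pe => @pc_elt_neq_inr _ _ Z 1%g y (esym pe)) (fun nVp => nVp Vp).
apply: sub_finite_set => h nUh; exists (pc_elt Z (val h)); split.
  by exists (pc_elt Z 1%g) => //; rewrite /a pc_act_elt mulg1.
by move/VU.
Qed.

(** Each translate of [K] is closed and misses the fixed point [p], so the finitely many translates
    by elements outside [A] can be avoided near [p]. *)
Lemma stab_translates_near (K : set Z) (A : set P) : compact K -> ~ K p ->
  cofinitely A -> \forall x \near p, forall h k, K k -> x = a h k -> A h.
Proof.
move=> cK Kp fA.
have aKc h : closed (a h @` K).
  apply: compact_closed; first exact: pc_hausdorff.
  apply: continuous_compact cK; apply: continuous_subspaceT.
  exact: act_continuous.
have : \forall x \near p, forall h : P, (~` A) h -> (~` (a h @` K)) x.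
  apply: filter_finite_set => // h _; apply: open_nbhs_nbhs; split.
    exact: closed_openC.
  by move=> [k Kk kp]; apply: Kp; have <- : k = p by rewrite -(a_invK h k) kp a_fix.
apply: filterS => x Ax h k Kk xE; apply: contrapT => nAh.
by apply: (Ax h nAh); exists k.
Qed.

(** For finite [P] the empty set is cofinite, so some neighbourhood of [p] meets no translate of
    [K]; by density it contains an element of [G], which the translates of [K] must cover. *)
Lemma infinite_stab : infinite_set [set: P].
Proof.
move=> Pfin.
have fin0 : @cofinitely P set0 by apply: sub_finite_set Pfin.
have [K [cK Kp Kcov]] := parabolic_cover.
have [g _ /= nKg] := pc_elt_near_inr (stab_translates_near cK Kp fin0) filterT.
have [h [k [Kk gk]]] := Kcov _ (@pc_elt_neq_inr _ _ Z g y).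
exact: (nKg h k).
Qed.

(** * Spreading a slowly oscillating function from the stabilizer to [G] *)

Section Spread.
Variables (R : realType) (phi : P -> R) (K : set Z) (psi : Z -> R).
Hypothesis phi01 : forall h, 0 <= phi h <= 1.
Hypothesis phi_slow : slowly_oscillating phi.
Hypothesis cK : compact K.
Hypothesis Kp : ~ K p.
Hypothesis Kcov : forall x, x <> p -> exists h k, K k /\ x = a h k.
Hypothesis psi_c : continuous psi.
Hypothesis psi1 : forall x, psi x <= 1.
Hypothesis psip : psi p = 0.
Hypothesis psiK : forall k, K k -> psi k = 1.

(** The threshold 1/2 is where [2 * psi x - 1] changes sign: [theta] vanishes off the compact set
    [L], which contains [K] and misses [p], and equals 1 on [K]. *)
Let L := [set x | 2^-1 <= psi x].
Let theta x := Num.max 0 (2 * psi x - 1).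

Let cL : compact L.
Proof.
apply: (subclosed_compact _ (@pc_compact _ _ Z)) => //.
apply: (@preimage_closed _ _ psi [set t | 2^-1 <= t]); last exact: closed_ge.
by move=> x _; exact: psi_c.
Qed.

Let Lp : ~ L p.
Proof. by rewrite /L /= psip leNgt invr_gt0 ltr0n. Qed.

Let KL : K `<=` L.
Proof. by move=> k Kk; rewrite /L /= psiK // invf_le1 // ler1n. Qed.

Let theta_c : continuous theta.
Proof.
move=> x; apply: (@continuous_max _ _ (fun=> 0) (fun x => 2 * psi x - 1)).
  exact: cst_continuous.
apply: cvgB; last exact: cvg_cst.
by apply: cvgMr; exact: psi_c.
Qed.

Let theta01 x : 0 <= theta x <= 1.
Proof.
rewrite /theta le_max lexx /= ge_max ler01 /=.
by rewrite lerBlDr -[1 + 1]/(2%:R) -[leRHS]mulr1 ler_pM2l.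
Qed.

Let thetaK k : K k -> theta k = 1.
Proof.
by move=> Kk; rewrite /theta psiK // mulr1 -[2]/(1 + 1) addrK max_r.
Qed.

Let theta_supp x : theta x != 0 -> L x.
Proof.
rewrite /L /=; apply: contraNT; rewrite -ltNge => px; apply/eqP/max_l.
by rewrite subr_le0 -ler_pdivlMl // mulr1 ltW.
Qed.

(** The factor [theta] is a bump on the translate of [K] by [h]. A supremum replaces a sum weighted
    by a partition of unity, so the overlapping bumps need no normalisation. *)
Definition spread (g : G) : R :=
  sup (range (fun h : P => phi h * theta (a h^-1%g (pc_elt Z g)))).

Let term01 g h : 0 <= phi h * theta (a h^-1%g (pc_elt Z g)) <= 1.
Proof.
have /andP[p0 p1] := phi01 h; have /andP[t0 t1] := theta01 (a h^-1%g (pc_elt Z g)).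
by rewrite mulr_ge0 //= mulr_ile1.
Qed.

Let spread_le g c : (forall h, phi h * theta (a h^-1%g (pc_elt Z g)) <= c) ->
  spread g <= c.
Proof.
move=> hc; apply: ge_sup; first by exists (phi 1%g * theta (a 1^-1%g (pc_elt Z g))), 1%g.
by move=> _ [h _ <-].
Qed.

Let spread_ge g h : phi h * theta (a h^-1%g (pc_elt Z g)) <= spread g.
Proof.
apply: ub_le_sup; last by exists h.
by exists 1 => _ [k _ <-]; case/andP: (term01 g k).
Qed.

Lemma spread01 g : 0 <= spread g <= 1.
Proof.
rewrite spread_le ?andbT => [|h]; last by case/andP: (term01 g h).
by apply: le_trans (spread_ge g 1%g); case/andP: (term01 g 1%g).
Qed.

Let F0 := [set s : P | (a s @` L) `&` L !=set0].

Let F0_fin : finite_set F0.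
Proof. exact: parabolic_finite. Qed.

(** The term at [h] has [theta] equal to 1 and gives the lower bound. Any other contributing [h']
    lies in [h F0], because the translates of [L] by [h] and [h'] share the point [g]; hence
    [phi h'] exceeds [phi h] by at most [eps]. *)
Let spread_near g h k eps : pc_elt Z g = a h k -> K k -> 0 <= eps ->
  (forall s, F0 s -> `|phi h - phi (h * s)%g| < eps) ->
  phi h <= spread g <= phi h + eps.
Proof.
move=> gE Kk eps0 hF0; apply/andP; split.
  by apply: le_trans (spread_ge g h); rewrite gE a_invK thetaK // mulr1.
apply: spread_le => h'.
have [->|/theta_supp Lh'] := eqVneq (theta (a h'^-1%g (pc_elt Z g))) 0.
  by rewrite mulr0 addr_ge0 //; case/andP: (phi01 h).
have F0s : F0 (h^-1 * h')%g.
  exists k; split; last exact: KL.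
  exists (a h'^-1%g (pc_elt Z g)) => //.
  by rewrite a_mul aK_inv gE a_invK.
have := hF0 _ F0s; rewrite mulVKg => hh'.
have /andP[t0 t1] := theta01 (a h'^-1%g (pc_elt Z g)).
have /andP[p0 p1] := phi01 h'.
apply: (@le_trans _ _ (phi h')); first by rewrite ler_piMr.
by rewrite -lerBlDl (le_trans (ler_norm _)) // distrC ltW.
Qed.

(** Since [psi] is 1 at [b], it exceeds 1/2 at [b * g] for all but finitely many [b]. So [b * g]
    stays in [L] enlarged by finitely many points, a compact set missing [p]. *)
Let translate_finite (g : G) : exists2 F : set P, finite_set F &
  forall b s k, K (pc_elt Z b) -> K k -> pc_elt Z (b * g)%g = a s k -> F s.
Proof.
have half0 : 0 < 2^-1 :> R by rewrite invr_gt0 ltr0n.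
pose u : set (R * R) := [set xy | `|xy.1 - xy.2| < 2^-1].
have entu : entourage u by rewrite -entourage_ballE; exists 2^-1.
pose B := ~` [set b | u (psi (pc_elt Z b), psi (pc_elt Z (b * g)%g))].
have Bfin : finite_set B := pc_uniformly_slow g psi_c entu.
pose M := L `|` (fun b => pc_elt Z (b * g)%g) @` B.
have cM : compact M by apply: compactU => //; exact/finite_compact/finite_image.
have Mp : ~ M p by move=> [//|[b _]]; exact: pc_elt_neq_inr.
exists [set s : P | (a s @` K) `&` M !=set0]; first exact: parabolic_finite.
move=> b s k Kb Kk bE; exists (pc_elt Z (b * g)%g); split.
  by exists k.
have [Bb|/contrapT] := pselect (B b); first by right; exists b.
rewrite /u /= psiK // ltr_distlC => /andP[+ _] => h; left.
by rewrite /L /=; lra.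
Qed.

(** With [h] in the translate of [K] by [k] and [h * g] in that by [k'], [spread] is within [d] of
    [phi k] and [phi k'] respectively. These differ by less than [d], as [k^-1 * k'] ranges over the
    finite set [F1]. *)
Let slow_near_p g eps : 0 < eps ->
  \forall x \near p & h \near @cofinitely G,
    x = pc_elt Z h -> `|spread h - spread (h * g)%g| < eps.
Proof.
move=> eps0; pose d := eps / 3.
have d0 : 0 < d by rewrite divr_gt0.
have [F1 F1fin F1P] := translate_finite g.
pose A := [set h : P | forall s, (F0 `|` F1) s -> `|phi h - phi (h * s)%g| < d].
have fA : \forall h \near @cofinitely P, A h.
  apply: (@filter_finite_set _ _ _ (F0 `|` F1)
    (fun s h => `|phi h - phi (h * s)%g| < d)); first by rewrite finite_setU.
  by move=> s _; exact: phi_slow.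
have nA := stab_translates_near cK Kp fA.
have [[U1 U2] [nU1 nU2] U12] := pc_near_translate g nA.
near=> x h => /= xE.
have [k [b [Kb hE]]] := Kcov (@pc_elt_neq_inr _ _ Z h y).
have [k' [b' [Kb' hE']]] := Kcov (@pc_elt_neq_inr _ _ Z (h * g)%g y).
have Ak : A k.
  suff : forall h k, K k -> x = a h k -> A h by apply; [exact: Kb|rewrite xE].
  by near: x; exact: nA.
have Ak' : A k'.
  have U12xh : U1 x /\ U2 h by split; [near: x|near: h].
  exact: (U12 (x, h) U12xh xE _ _ Kb' hE').
have F1s : F1 (k^-1 * k')%g.
  (* Translating back by [k] brings [h] into [K], where [F1P] applies. *)
  apply: (F1P (val k^-1 * h)%g _ b') => //.
    by rewrite -pc_act_elt -/(a _ _) hE a_invK.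
  by rewrite -mulgA -pc_act_elt hE' a_mul.
have /andP[l1 r1] := spread_near hE Kb (ltW d0) (fun s Fs => Ak s (or_introl Fs)).
have /andP[l2 r2] := spread_near hE' Kb' (ltW d0) (fun s Fs => Ak' s (or_introl Fs)).
have := Ak _ (or_intror F1s); rewrite mulVKg !ltr_distl => /andP[l3 r3].
have epsE : eps = d + d + d by rewrite /d; field.
by rewrite epsE; apply/andP; split; lra.
Unshelve. all: by end_near. Qed.

(** Only the finitely many [h] in [FN] contribute on [B]. Both arguments of [spread] eventually lie
    in [B], and each of these finitely many bumps varies slowly. *)
Let slow_away_p g eps x : x <> p -> 0 < eps ->
  \forall x' \near x & h \near @cofinitely G,
    x' = pc_elt Z h -> `|spread h - spread (h * g)%g| < eps.
Proof.
move=> xp eps0.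
have [B nB Bp] : exists2 B, nbhs x B & closure B `<=` ~` [set p].
  apply: uniform_regular; apply: open_nbhs_nbhs; split=> //.
  exact/closed_openC/accessible_closed_set1/hausdorff_accessible/pc_hausdorff.
have cB : compact (closure B).
  by apply: (subclosed_compact _ (@pc_compact _ _ Z)) => //; exact: closed_closure.
pose FN := [set h : P | (a h @` L) `&` closure B !=set0].
have FNfin : finite_set FN by apply: parabolic_finite => // /Bp; exact.
have FNout h b : ~ FN h -> B (pc_elt Z b) -> theta (a h^-1%g (pc_elt Z b)) = 0.
  move=> nFh Bb; apply/eqP; apply: contra_notT nFh => /theta_supp Lb.
  exists (pc_elt Z b); split; last exact: subset_closure.
  by exists (a h^-1%g (pc_elt Z b)); rewrite ?aK_inv.
have [[U1 U2] [nU1 nU2] U12] := pc_near_translate g nB.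
have h20 : 0 < eps / 2 by rewrite divr_gt0.
pose u : set (R * R) := [set xy | `|xy.1 - xy.2| < eps / 2].
have entu : entourage u by rewrite -entourage_ballE; exists (eps / 2).
have nFN : \forall b \near @cofinitely G, forall h, FN h ->
    u (theta (a h^-1%g (pc_elt Z b)), theta (a h^-1%g (pc_elt Z (b * g)%g))).
  apply: filter_finite_set => // h _.
  apply: (@pc_uniformly_slow _ _ Z _ (fun z => theta (a h^-1%g z))) => //.
  move=> z; apply: continuous_comp; [exact: act_continuous|exact: theta_c].
near=> x' b => /= x'E.
(* Strict bounds on the terms become weak for the supremum, hence [eps / 2]. *)
apply: (@le_lt_trans _ _ (eps / 2)); last by rewrite ltr_pdivrMr // ltr_pMr // ltr1n.
have Bb : B (pc_elt Z b) by rewrite -x'E; near: x'.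
have Bbg : B (pc_elt Z (b * g)%g).
  have U12b : U1 x' /\ U2 b by split; [near: x'|near: b].
  exact: (U12 (x', b) U12b x'E).
have ub : forall h, FN h ->
    u (theta (a h^-1%g (pc_elt Z b)), theta (a h^-1%g (pc_elt Z (b * g)%g))).
  by near: b.
apply: (sup_range_dist 1%g) => // h.
rewrite -mulrBr normrM; have /andP[p0 p1] := phi01 h; rewrite ger0_norm //.
have [/ub/ltW hF|nF] := pselect (FN h).
  by apply: le_trans hF; rewrite ler_piMl.
by rewrite !FNout // subr0 normr0 mulr0 ltW.
Unshelve. all: by end_near. Qed.

Lemma spread_slow : slowly_oscillating spread.
Proof.
move=> g eps eps0.
have /compact_near_coveringP cov := @pc_compact _ _ Z.
suff Lh x : [set: Z] x -> \forall x' \near x & h \near @cofinitely G,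
    x' = pc_elt Z h -> `|spread h - spread (h * g)%g| < eps.
  apply: filterS (cov _ _ _ _ Lh) => h Zh; exact: (Zh (pc_elt Z h) I erefl).
move=> _; have [->|xp] := pselect (x = p); first exact: slow_near_p.
exact: slow_away_p.
Qed.

(** The point 1 need not lie in [K], but it lies in a translate by some [h1]. So [spread] at [h] is
    within [d] of [phi (h * h1)], which slow oscillation compares with [phi h]. *)
Lemma spread_stab eps : 0 < eps ->
  \forall h \near @cofinitely P, `|spread (val h) - phi h| < eps.
Proof.
move=> eps0; pose d := eps / 2.
have d0 : 0 < d by rewrite divr_gt0.
have [h1 [k [Kk kE]]] := Kcov (@pc_elt_neq_inr _ _ Z 1%g y).
pose A := [set h : P | forall s, F0 s -> `|phi h - phi (h * s)%g| < d].
have fA : \forall h \near @cofinitely P, A h.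
  apply: (@filter_finite_set _ _ _ F0 (fun s h => `|phi h - phi (h * s)%g| < d)) => //.
  by move=> s _; exact: phi_slow.
have nA := cofinitely_mulr h1 fA.
have n1 := phi_slow h1 d0.
near=> h.
have hE : pc_elt Z (val h) = a (h * h1)%g k.
  by rewrite a_mul -kE /a pc_act_elt mulg1.
have Ah : A (h * h1)%g by near: h.
have /andP[l1 r1] := spread_near hE Kk (ltW d0) Ah.
have : `|phi h - phi (h * h1)%g| < d by near: h.
rewrite !ltr_distl => /andP[l2 r2].
have epsE : eps = d + d by rewrite /d; field.
by rewrite epsE; apply/andP; split; lra.
Unshelve. all: by end_near. Qed.

End Spread.
End Parabolic.

(** * Separating functions and the size of the remainder *)

Lemma continuous_separation (R : realType) (T : uniformType) (x : T) (B : set T) :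
  closed B -> ~ B x -> exists f : T -> R, [/\ continuous f,
    (forall t, 0 <= f t <= 1), f x = 0 & forall t, B t -> f t = 1].
Proof.
move=> cB nBx.
have /(@uniform_separatorP _ R)[f [fc f01 fx fB]] :=
  @point_uniform_separator R T x B cB nBx.
exists f; split=> //; [|by apply: fx; exists x|by move=> t Bt; apply: fB; exists t].
by move=> t; have := f01 (f t) (imageT _ _); rewrite /= in_itv.
Qed.

(** The number [l] is the value at [p] of the extension to [Z] of the spread of [w]. Every remainder
    point of [W] is approached by elements of [P] outside any finite set, which tend to [p] in [Z].
    A fixed bound suffices to exclude [w] taking both values 0 and 1 there. *)
Lemma remainder_value (R : realType) (G : groupType) (Y : topologicalType)
    (Z : perspective_compactification G Y) (Zmax : maximal_perspective Z)
    (p : Y) (hp : bounded_parabolic (pc_act Z) (pc_pt Z (inr p)))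
    (Cp : topologicalType)
    (W : perspective_compactification
           (stabilizer (pc_act Z) (pc_pt Z (inr p))) Cp)
    (w : W -> R) : continuous w -> (forall x, 0 <= w x <= 1) ->
  exists l : R, forall c, `|l - w (pc_pt W (inr c))| < 2^-1.
Proof.
move=> wc w01.
have near_ball (V : uniformType) (q : V -> R) x (eps : R) : continuous q -> 0 < eps ->
    \forall x' \near x, `|q x - q x'| < eps.
  by move=> qc eps0; exact: qc x _ (nbhsx_ballx (q x) eps eps0).
pose phi h := w (pc_elt W h).
have phi_slow : slowly_oscillating phi.
  move=> g eps eps0.
  have entu : entourage [set xy : R * R | `|xy.1 - xy.2| < eps].
    by rewrite -entourage_ballE; exists eps.
  exact: (pc_uniformly_slow g wc entu).
have [K [cK Kp Kcov]] := parabolic_cover hp.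
have [psi [psi_c psi01 psip psiK]] := continuous_separation R
  (compact_closed (@pc_hausdorff _ _ Z) cK) Kp.
have psi1 x : psi x <= 1 by case/andP: (psi01 x).
have phi01 h : 0 <= phi h <= 1 by exact: w01.
have [F Fc FE] := slowly_oscillating_extends Zmax (spread01 phi01 psi1)
  (spread_slow hp phi01 phi_slow cK Kp Kcov psi_c psi1 psip psiK).
(* Three errors of 1/8 add up: [F] at [p] against [F] at [h], [spread] against [phi], and [w] at [h]
   against [w] at [c]. *)
have e8 : 0 < 8^-1 :> R by rewrite invr_gt0 ltr0n.
exists (F (pc_pt Z (inr p))) => c.
have nF := stab_elt_cvg hp (near_ball _ _ _ _ Fc e8).
have nphi := spread_stab hp phi01 phi_slow Kcov psi_c psi1 psip psiK e8.
have [h [hF hphi] hc] :=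
  pc_elt_near_inr (near_ball _ _ (pc_pt W (inr c)) _ wc e8) (filterI nF nphi).
move: hF hphi hc => /=; rewrite FE !ltr_distl /phi.
by move=> /andP[? ?] /andP[? ?] /andP[? ?]; apply/andP; split; lra.
Qed.

Theorem theorem3p29 (G : groupType) (Y : topologicalType)
    (Z : perspective_compactification G Y) (Zmax : maximal_perspective Z)
    (p : Y) (hp : bounded_parabolic (pc_act Z) (pc_pt Z (inr p)))
    (Cp : topologicalType)
    (W : perspective_compactification
           (stabilizer (pc_act Z) (pc_pt Z (inr p))) Cp) :
  ([set: Cp] #= `I_1)%card.
Proof.
have [c _] := pc_remainder_nonempty W (infinite_stab hp).
suff -> : [set: Cp] = [set c] by exact: card_set1.
apply/seteqP; split=> // d _ /=; apply: contrapT => dc.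
have cd : closed [set pc_pt W (inr d)].
  exact/accessible_closed_set1/hausdorff_accessible/pc_hausdorff.
have [|w [wc w01 wc0 wd1]] := @continuous_separation Rdefinitions.R _ (pc_pt W (inr c)) _ cd.
  by move=> /(bij_inj (pc_pt_bij W)) [] /esym.
have [l lE] := remainder_value Zmax hp wc w01.
(* The number [l] would be at distance less than 1/2 from both 0 and 1. *)
have := lE c; have := lE d; rewrite wc0 wd1 // !ltr_distl.
move=> /andP[l1 _] /andP[_ l0]; have := lt_trans l1 l0.
by rewrite ltrBlDr add0r -[2^-1]div1r -splitr ltxx.
Qed.
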